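(* For $i=1,2$, let $G_i$ be a finite, simple, connected graph of order $n_i$ with metric dimension $k_i$, exactly one metric basis, and maximum degree $\Delta(G_i)=n_i-1$. Then there exists a finite, simple, connected graph $G$ of order $n_1+n_2-1$ with metric dimension $k_1+k_2$, exactly one metric basis, and maximum degree $\Delta(G)=n_1+n_2-2$.
   Context: For vertices $u,v$ of a connected graph $G$, $d(u,v)$ is the distance between them. For an ordered set $W=\{w_1,\dots,w_k\}\subseteq V(G)$ and $v\in V(G)$, $r(v|W)=(d(v,w_1),\dots,d(v,w_k))$. $W$ is a resolving set if distinct vertices have distinct representations $r(\cdot|W)$. A resolving set of minimum cardinality is a metric basis; its cardinality is the metric dimension $\beta(G)$. *)

(* Defs.v *)
From mathcomp Require Import all_boot.

Set Implicit Arguments.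
Unset Strict Implicit.
Unset Printing Implicit Defensive.

(* Finite simple graphs: a symmetric irreflexive adjacency relation. *)
Record sgraph := SGraph {
  vertex :> finType;
  adj : rel vertex;
  adj_sym : symmetric adj;
  adj_irrefl : irreflexive adj
}.

Section Graph.
Variable G : sgraph.
Implicit Types (u v w : G) (W : {set G}) (s : seq G).

(* The null graph is not connected, so orders n below satisfy 0 < n. *)
Definition connected_graph : Prop :=
  0 < #|G| /\ forall u v, connect (@adj G) u v.

Definition degree v : nat := #|[set u | adj v u]|.

Definition max_degree : nat := \max_(v : G) degree v.

Definition has_walk u v (n : nat) : bool :=
  [exists p : n.-tuple G, path (@adj G) u p && (last u p == v)].

(* The least n such that a walk of length n joins u to v; the search stops at
   #|G|, which is returned exactly when u and v are not connected (see distP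
   for connected graphs). *)
Definition dist u v : nat := find (has_walk u v) (iota 0 #|G|).

Definition representation s v : seq nat := [seq dist v w | w <- s].

(* Being resolving does not depend on how W is ordered, so sets are listed in
   their canonical order. The empty set is allowed: it resolves the one-vertex
   graph, whose metric dimension is therefore 0. *)
Definition resolving W : bool := injectiveb (representation (enum W)).

(* The default value setT is always resolving, see resolvingT. *)
Definition metric_dim : nat :=
  #|[arg min_(W < [set: G] | resolving W) #|W|]|.

Definition metric_basis W : bool := resolving W && (#|W| == metric_dim).

Lemma has_walkP u v n :
  reflect (exists p : seq G, [/\ path (@adj G) u p, last u p = v & size p = n])
          (has_walk u v n).
Proof.
apply: (iffP existsP) => [[p /andP[up /eqP lp]]|[p [up lp sp]]].
  by exists p; rewrite size_tuple.
have sp' : size p == n by apply/eqP.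
by exists (Tuple sp'); rewrite /= up lp eqxx.
Qed.

Lemma distP u v : connect (@adj G) u v ->
  has_walk u v (dist u v) /\ forall n, has_walk u v n -> dist u v <= n.
Proof.
case/connectP=> p0 /shortenP[p up Up _] lp.
have ltp : size p < #|G| by rewrite -[(size p).+1]/(size (u :: p)) -(card_uniqP Up) max_card.
have hp : has (has_walk u v) (iota 0 #|G|).
  apply/hasP; exists (size p); first by rewrite mem_iota.
  by apply/has_walkP; exists p.
have ltd : dist u v < #|G| by rewrite -[#|G|](size_iota 0) -has_find.
split; first by have := nth_find 0 hp; rewrite -/(dist u v) nth_iota.
move=> n wn; rewrite leqNgt; apply/negP=> ltn.
have := before_find 0 ltn; rewrite nth_iota ?add0n ?wn //.
exact: ltn_trans ltd.
Qed.

Lemma dist_eq0 u v : (dist u v == 0) = (u == v).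
Proof.
have G0 : 0 < #|G| by apply/card_gt0P; exists u.
apply/eqP/eqP => [d0|->].
  suff /has_walkP[p [_ lp /size0nil p0]] : has_walk u v 0 by rewrite p0 in lp.
  move: d0; rewrite /dist; case: #|G| G0 => //= k _.
  by case: (has_walk u v 0).
rewrite /dist; case: #|G| G0 => //= k _.
suff -> : has_walk v v 0 by [].
by apply/has_walkP; exists [::].
Qed.

Lemma resolvingT : resolving [set: G].
Proof.
apply/injectiveP=> u v /eq_in_map/(_ v); rewrite mem_enum inE => /(_ isT) E.
by apply/eqP; rewrite -dist_eq0 E dist_eq0.
Qed.

Lemma metric_dimP :
  (exists2 W, resolving W & #|W| = metric_dim) /\
  (forall W, resolving W -> metric_dim <= #|W|).
Proof.
rewrite /metric_dim; case: arg_minnP; first exact: resolvingT.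
by move=> W rW minW; split; first by exists W.
Qed.

End Graph.

(* Main.v *)
(** Each [G_i] has a vertex [c_i] adjacent to all others, so its distances are
    0, 1 or 2. Let [G] be the join of [G_1] and [G_2] with [c_1] and [c_2]
    identified to a vertex [c]. A vertex outside the copy of [G_i] is at
    distance 1 from that whole copy, so it separates no two of its vertices,
    and a set [W] resolving [G] restricts to resolving sets of both [G_i].
    Moreover [c_i] is not in the unique basis [W_i], because it could be
    exchanged for another vertex; so when [W] contains [c], its two
    restrictions, which share [c], have more than [k_1] and [k_2] elements.
    Thus [#|W| >= k_1 + k_2], with equality only for [W_1 :|: W_2]. The latter
    set does resolve [G]: vertices of different copies are separated because
    [W_i] separates [c_i] from the other vertices of [G_i]. *)

Require Import Defs.
From mathcomp Require Import all_boot.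

Set Implicit Arguments.
Unset Strict Implicit.
Unset Printing Implicit Defensive.

(** * Resolving sets without an ordering, and unique bases *)

Definition universal (G : sgraph) (c : G) : Prop := forall v, v != c -> adj c v.

Lemma resolvingP (G : sgraph) (W : {set G}) :
  reflect (forall u v, {in W, forall w, dist u w = dist v w} -> u = v)
          (resolving W).
Proof.
apply: (iffP (injectiveP _)) => rW u v.
  by move=> E; apply: rW; apply/eq_in_map=> w; rewrite mem_enum; apply: E.
by move/eq_in_map=> E; apply: rW => w Ww; apply: E; rewrite mem_enum.
Qed.

Lemma unique_basisP (G : sgraph) (W0 : {set G}) :
  resolving W0 ->
  (forall W : {set G}, resolving W -> #|W0| <= #|W|) ->
  (forall W : {set G}, resolving W -> #|W| = #|W0| -> W = W0) ->
  metric_dim G = #|W0| /\ exists! W : {set G}, metric_basis W.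
Proof.
move=> rW0 minW0 uniqW0; have [[W rW cW] mind] := metric_dimP G.
have dimE : metric_dim G = #|W0|.
  by apply/eqP; rewrite eqn_leq mind // -cW minW0.
split=> //; exists W0; split=> [|W' /andP[rW' /eqP cW']].
  by rewrite /metric_basis rW0 dimE eqxx.
by rewrite (uniqW0 _ rW') // cW'.
Qed.

(** * Graphs with a universal vertex *)

Section Universal.
Variables (G : sgraph) (c : G).

Lemma neighbours_subset (v : G) : [set u | adj v u] \subset [set~ v].
Proof.
by apply/subsetP=> u; rewrite !inE; apply: contraTneq => ->; rewrite adj_irrefl.
Qed.

Lemma degree_le (v : G) : degree v <= #|G|.-1.
Proof. by rewrite -(cardsC1 v) subset_leq_card ?neighbours_subset. Qed.

Lemma universalP : degree c = #|G|.-1 <-> universal c.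
Proof.
split=> [E v vc|uc].
  have /eqP/setP/(_ v) : [set u | adj c u] == [set~ c].
    by rewrite eqEcard neighbours_subset cardsC1 -E leqnn.
  by rewrite !inE vc.
rewrite -(cardsC1 c) /degree; congr #|pred_of_set _|.
apply/eqP; rewrite eqEsubset neighbours_subset.
by apply/subsetP=> u; rewrite !inE => /uc.
Qed.

Hypothesis uc : universal c.

Lemma universal_max_degree : max_degree G = #|G|.-1.
Proof.
apply/eqP; rewrite eqn_leq; apply/andP; split.
  by apply/bigmax_leqP=> v _; apply: degree_le.
by rewrite -(universalP.2 uc) leq_bigmax.
Qed.

Lemma universal_connected : connected_graph G.
Proof.
split=> [|u v]; first by apply/card_gt0P; exists c.
have cc w : connect (@adj G) c w.
  by have [->|/uc cw] := eqVneq w c; [apply: connect0 | apply: connect1].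
by apply: connect_trans (cc v); rewrite (sym_connect_sym (@adj_sym G)).
Qed.

(** The detour through [c] is a walk of length 2 between any two distinct nonadjacent vertices, both
    then different from [c]. *)
Lemma universal_dist (u v : G) :
  dist u v = if u == v then 0 else if adj u v then 1 else 2.
Proof.
have [/eqP|uv] := ifP; first by move=> ->; apply/eqP; rewrite dist_eq0.
have [wd mind] := distP (universal_connected.2 u v).
have d0 : 0 < dist u v by rewrite lt0n dist_eq0 uv.
have [auv|nauv] := ifP.
  apply/eqP; rewrite eqn_leq d0 mind //.
  by apply/has_walkP; exists [:: v]; rewrite /= auv.
apply/eqP; rewrite eqn_leq; apply/andP; split.
  apply: mind; apply/has_walkP; exists [:: c; v].
  have cv : v != c.
    by apply: contraFneq nauv => vc; rewrite vc adj_sym uc // -vc uv.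
  have cu : u != c by apply: contraFneq nauv => ->; apply: uc.
  by rewrite /= adj_sym (uc cu) (uc cv).
rewrite ltn_neqAle d0 andbT eq_sym; apply: contraFneq nauv => d1.
rewrite d1 in wd; have /has_walkP[[|x [|y p]] [//= ax lx _]] := wd.
by move: ax lx; rewrite andbT => + <-.
Qed.

Lemma dist_universal (v : G) : v != c -> dist c v = 1.
Proof. by move=> vc; rewrite universal_dist eq_sym (negPf vc) uc. Qed.

(* If [c] lies in [W], then only pairs with [c] need it; at most one vertex [u]
   is then separated from [c] by [c] alone, and [u] can replace [c]. *)
Lemma universal_notin_unique_basis (W : {set G}) :
  resolving W -> (forall W' : {set G}, resolving W' -> #|W| <= #|W'|) ->
  (forall W' : {set G}, resolving W' -> #|W'| = #|W| -> W' = W) -> c \notin W.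
Proof.
move=> rW minW uniqW; apply/negP=> cW; have rWP := resolvingP _ rW.
have dist_c x : x != c -> dist x c = 1.
  by move=> xc; rewrite universal_dist (negPf xc) adj_sym uc.
have cardW : #|W| = #|W :\ c|.+1 by rewrite (cardsD1 c) cW.
have sepD x y : {in W :\ c, forall w, dist x w = dist y w} ->
    x != c -> y != c -> x = y.
  move=> E xc yc; apply: rWP => w wW; have [->|wc] := eqVneq w c.
    by rewrite !dist_c.
  by apply: E; rewrite !inE wc.
(* Such a [u] is exactly a vertex other than [c] that [W :\ c] fails to separate from [c]. If there
   is none, [W :\ c] still resolves, against the minimality of [W]. *)
have [u /andP[uc' /forall_inP uD]|noU] :=
  pickP [pred u | (u != c) && [forall w in W :\ c, dist u w == 1]]; last first.
  have : resolving (W :\ c).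
    have sepc y : {in W :\ c, forall w, dist y w = dist c w} -> y = c.
      move=> E; apply/eqP/negPn/negP=> yc; move/negP: (noU y); apply.
      rewrite /= yc; apply/forall_inP=> w wW.
      by rewrite E // dist_universal //; case/setD1P: wW.
    apply/resolvingP=> x y E; have [xc|xc] := eqVneq x c.
      by rewrite xc; apply/esym/sepc=> w wW; rewrite -E // xc.
    have [yc|yc] := eqVneq y c; last exact: sepD.
    by rewrite yc; apply/sepc=> w wW; rewrite E // yc.
  by move/minW; rewrite cardW ltnn.
have uW : u \notin W :\ c.
  by apply/negP=> /uD; rewrite universal_dist eqxx.
have rW' : resolving (u |: W :\ c).
  have sepc y : {in u |: W :\ c, forall w, dist y w = dist c w} -> y = c.
    move=> E; apply/eqP/negPn/negP=> yc.
    (* Both [y] and [u] are at distance 1 from all of [W :\ c], and this set separates vertices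
       other than [c]. *)
    have yu : y = u.
      apply: sepD => // w wW; rewrite (eqP (uD _ wW)) E ?setU1r //.
      by rewrite dist_universal //; case/setD1P: wW.
    by have := E u (setU11 _ _); rewrite yu dist_universal // universal_dist eqxx.
  apply/resolvingP=> x y E; have [xc|xc] := eqVneq x c.
    by rewrite xc; apply/esym/sepc=> w wW; rewrite -E // xc.
  have [yc|yc] := eqVneq y c.
    by rewrite yc; apply/sepc=> w wW; rewrite E // yc.
  by apply: sepD => // w wW; apply: E; rewrite setU1r.
have W'E : u |: W :\ c = W by apply: uniqW; rewrite // cardsU1 uW cardW.
by move: cW; rewrite -W'E !inE eqxx eq_sym (negPf uc').
Qed.

End Universal.

Lemma universal_exists (G : sgraph) :
  connected_graph G -> max_degree G = #|G|.-1 -> exists c : G, universal c.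
Proof.
move=> [G0 _]; rewrite /max_degree.
by have [c ->] := eq_bigmax (@degree G) G0; exists c; apply/universalP.
Qed.

(** * Induced copies of a graph that share its universal vertex *)

Section Copy.
Variables (H G : sgraph) (f : H -> G) (cH : H).
Hypotheses (ucH : universal cH) (ucG : universal (f cH)).
Hypotheses (f_inj : injective f) (f_adj : {mono f : x y / adj x y}).

(** On both sides a universal vertex makes distance a function of equality and adjacency, which [f]
    preserves. *)
Lemma copy_dist : {mono f : x y / dist x y}.
Proof.
by move=> x y; rewrite (universal_dist ucG) (universal_dist ucH) inj_eq ?f_adj.
Qed.

(** A vertex of [W] outside the copy is at distance 1 from the whole copy, so all separation inside
    the copy is done by the preimage of [W]. *)
Lemma copy_resolving (W : {set G}) :
  (forall z, z \notin codom f -> forall x, adj (f x) z) ->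
  resolving W -> resolving (f @^-1: W).
Proof.
move=> join /resolvingP rW; apply/resolvingP=> x y E; apply/f_inj/rW => w wW.
have [/codomP[w' wE]|/[dup] wf /join aw] := boolP (w \in codom f).
  by rewrite wE !copy_dist; apply: E; rewrite inE -wE.
rewrite !(universal_dist ucG) !aw.
have neq z : (f z == w) = false by apply: contraNF wf => /eqP <-; apply: codom_f.
by rewrite !neq.
Qed.

Lemma copy_separated (W : {set H}) (x y : H) : resolving W ->
  {in W, forall w, dist (f x) (f w) = dist (f y) (f w)} -> x = y.
Proof.
by move=> /resolvingP rW E; apply: rW => w /E; rewrite !copy_dist.
Qed.

End Copy.

(** * The amalgam, described symmetrically by its two embeddings *)

Section Amalgam.
Variables (G1 G2 G : sgraph) (c1 : G1) (c2 : G2).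
Variables (f1 : G1 -> G) (f2 : G2 -> G).
Hypotheses (uc1 : universal c1) (uc2 : universal c2).
Hypotheses (f1_inj : injective f1) (f2_inj : injective f2).
Hypotheses (f1_adj : {mono f1 : x y / adj x y}).
Hypotheses (f2_adj : {mono f2 : x y / adj x y}).
Hypothesis f12 : f1 c1 = f2 c2.
Hypothesis cross_adj : forall x y, x != c1 -> y != c2 -> adj (f1 x) (f2 y).
Hypothesis cover : forall z, z \in codom f1 \/ z \in codom f2.

Lemma amalgam_universal : universal (f1 c1).
Proof.
move=> z zc; case: (cover z) => /codomP[x zE]; rewrite zE in zc *.
  by rewrite f1_adj uc1 // -(inj_eq f1_inj).
by rewrite f12 f2_adj uc2 // -(inj_eq f2_inj) -f12.
Qed.
Let uc := amalgam_universal.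
Let uc' : universal (f2 c2). Proof. by rewrite -f12. Qed.

(** Any other common vertex would be adjacent to itself by [cross_adj]. *)
Lemma amalgam_meet x y : f1 x = f2 y -> x = c1.
Proof.
move=> E; apply/eqP/negPn/negP=> xc; have [yc|yc] := eqVneq y c2.
  by move/eqP: xc; apply; apply: f1_inj; rewrite E yc f12.
by have := cross_adj xc yc; rewrite E adj_irrefl.
Qed.

Lemma amalgam_join1 z : z \notin codom f1 -> forall x, adj (f1 x) z.
Proof.
move=> zf x; case: (cover z) => [zf'|/codomP[y zE]]; first by rewrite zf' in zf.
have yc : y != c2.
  by apply: contraNneq zf => yc; rewrite zE yc -f12 codom_f.
have [->|xc] := eqVneq x c1; last by rewrite zE cross_adj.
by rewrite zE f12 f2_adj uc2.
Qed.

Lemma amalgam_join2 z : z \notin codom f2 -> forall y, adj (f2 y) z.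
Proof.
move=> zf y; case: (cover z) => [/codomP[x zE]|zf']; last by rewrite zf' in zf.
have xc : x != c1.
  by apply: contraNneq zf => xc; rewrite zE xc f12 codom_f.
have [->|yc] := eqVneq y c2; last by rewrite zE adj_sym cross_adj.
by rewrite zE -f12 f1_adj uc1.
Qed.

(** Inclusion-exclusion: the copies cover [G] and meet only in [f1 c1]. *)
Lemma amalgam_card (W : {set G}) :
  #|f1 @^-1: W| + #|f2 @^-1: W| = #|W| + (f1 c1 \in W).
Proof.
rewrite -(card_imset _ f1_inj) -(card_imset _ f2_inj) -cardsUI.
congr (#|pred_of_set _| + _).
  apply/setP=> z; rewrite inE; apply/orP/idP.
    by case=> /imsetP[x]; rewrite inE => + ->.
  move=> zW; case: (cover z) => /codomP[x zE]; [left | right];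
    by rewrite zE imset_f // inE -zE.
have -> : f1 @: (f1 @^-1: W) :&: f2 @: (f2 @^-1: W) = W :&: [set f1 c1].
  apply/setP=> z; rewrite !inE; apply/andP/andP=> [[]|[zW /eqP zE]].
    case/imsetP=> x; rewrite inE => xW -> /imsetP[y _ /amalgam_meet xc].
    by split=> //; rewrite xc.
  by rewrite zE {2}f12 !imset_f // inE -?f12 -zE.
have [cW|cW] := boolP (f1 c1 \in W).
  by rewrite (setIidPr _) ?cards1 // sub1set.
by apply/eqP; rewrite cards_eq0 setI_eq0 disjoint_sym disjoints1.
Qed.

Lemma amalgam_order : #|G1| + #|G2| = #|G| + 1.
Proof. by have := amalgam_card setT; rewrite !preimsetT !cardsT inE. Qed.

Section Basis.
Variables (W1 : {set G1}) (W2 : {set G2}).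
Hypotheses (rW1 : resolving W1) (rW2 : resolving W2).
Hypotheses (cW1 : c1 \notin W1) (cW2 : c2 \notin W2).

Let W0 := f1 @: W1 :|: f2 @: W2.

Lemma amalgam_preim1 : f1 @^-1: W0 = W1.
Proof.
apply/setP=> x; rewrite !inE mem_imset //; apply/orb_idr => /imsetP[y yW E].
have xc := amalgam_meet E; move: E; rewrite xc f12 => /f2_inj yc.
by rewrite -yc (negPf cW2) in yW.
Qed.

Lemma amalgam_preim2 : f2 @^-1: W0 = W2.
Proof.
apply/setP=> y; rewrite !inE mem_imset //; apply/orb_idl => /imsetP[x xW /esym E].
by rewrite (amalgam_meet E) (negPf cW1) in xW.
Qed.

Lemma amalgam_basis_card : #|W0| = #|W1| + #|W2|.
Proof.
have := amalgam_card W0; rewrite amalgam_preim1 amalgam_preim2 => ->.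
have -> : (f1 c1 \in W0) = (c1 \in f1 @^-1: W0) by rewrite [RHS]inE.
by rewrite amalgam_preim1 (negPf cW1) addn0.
Qed.

Lemma amalgam_basis_resolving : resolving W0.
Proof.
have in1 w : w \in W1 -> f1 w \in W0 by move=> wW; rewrite inE imset_f.
have in2 w : w \in W2 -> f2 w \in W0 by move=> wW; rewrite inE imset_f ?orbT.
have same1 x y : {in W0, forall w, dist (f1 x) w = dist (f1 y) w} -> x = y.
  by move=> E; apply: (copy_separated uc1 uc f1_inj f1_adj rW1) => w /in1/E.
have same2 x y : {in W0, forall w, dist (f2 x) w = dist (f2 y) w} -> x = y.
  by move=> E; apply: (copy_separated uc2 uc' f2_inj f2_adj rW2) => w /in2/E.
have cross x y : {in W0, forall w, dist (f1 x) w = dist (f2 y) w} -> f1 x = f2 y.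
  move=> E; have [yc|yc] := eqVneq y c2.
    by rewrite yc -f12; congr f1; apply: same1 => w wW; rewrite E // yc f12.
  (* As [f2 y] lies outside the first copy, it is at distance 1 from every [f1 w] with [w] in [W1],
     and so is [f1 c1] because [c1] is not in [W1]. Hence [W1] does not separate [x] from [c1]. *)
  have xc : x = c1.
    apply: (copy_separated uc1 uc f1_inj f1_adj rW1) => w wW.
    have wc : w != c1 by apply: contraNneq cW1 => <-.
    rewrite E ?in1 // (dist_universal uc) ?inj_eq //.
    have a : adj (f2 y) (f1 w) by rewrite adj_sym cross_adj.
    rewrite (universal_dist uc) a ifF //; apply/negbTE.
    by apply: contraTneq a => ->; rewrite adj_irrefl.
  by rewrite xc f12; congr f2; apply: same2 => w wW; rewrite -E // xc f12.
apply/resolvingP=> u v E.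
case: (cover u) (cover v) E => /codomP[x ->] [] /codomP[y ->] E.
- by rewrite (same1 _ _ E).
- exact: cross.
- by apply/esym/cross=> w wW; rewrite E.
- by rewrite (same2 _ _ E).
Qed.

Hypothesis minW1 : forall W : {set G1}, resolving W ->
  #|W1| <= #|W| ?= iff (W == W1).
Hypothesis minW2 : forall W : {set G2}, resolving W ->
  #|W2| <= #|W| ?= iff (W == W2).

(** Both preimages of [W] resolve, so their sizes are bounded below by those of [W1] and [W2];
    [amalgam_card] turns this into a bound on [#|W|]. *)
Lemma amalgam_basis_min W : resolving W -> #|W0| <= #|W| ?= iff (W == W0).
Proof.
move=> rW; rewrite amalgam_basis_card.
have := minW1 (copy_resolving uc1 uc f1_inj f1_adj amalgam_join1 rW).
have := minW2 (copy_resolving uc2 uc' f2_inj f2_adj amalgam_join2 rW).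
move: (amalgam_card W); have [cW|cW] := boolP (f1 c1 \in W) => cardW min2 min1.
  have P1 : f1 @^-1: W != W1 by apply: contraNneq cW1 => <-; rewrite inE.
  have P2 : f2 @^-1: W != W2 by apply: contraNneq cW2 => <-; rewrite inE -f12.
  have lt1 : #|W1| < #|f1 @^-1: W| by rewrite ltn_neqAle min1 min1 P1.
  have lt2 : #|W2| < #|f2 @^-1: W| by rewrite ltn_neqAle min2 min2 P2.
  (* The shared vertex is counted twice, but both bounds are strict: a gain of two against a loss of
     one. *)
  have lt : #|W1| + #|W2| < #|W|.
    by have := leq_add lt1 lt2; rewrite cardW addn1 addSn addnS ltnS.
  split; first exact: ltnW.
  rewrite ltn_eqF //; apply/esym/negbTE; apply: contraTneq lt => ->.
  by rewrite amalgam_basis_card ltnn.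
rewrite addn0 in cardW; rewrite -cardW.
split; first exact: leq_add min1 min2.
(* Equality in the sum forces equality in both terms, and [W] is determined by its two preimages
   because the copies cover [G]. *)
rewrite (leqif_add min1 min2); apply/andP/eqP=> [[/eqP P1 /eqP P2]|->]; last first.
  by rewrite amalgam_preim1 amalgam_preim2.
apply/setP=> z; case: (cover z) => /codomP[x ->].
  have : (x \in f1 @^-1: W) = (x \in f1 @^-1: W0) by rewrite P1 amalgam_preim1.
  by rewrite [LHS]inE [RHS]inE.
have : (x \in f2 @^-1: W) = (x \in f2 @^-1: W0) by rewrite P2 amalgam_preim2.
by rewrite [LHS]inE [RHS]inE.
Qed.

End Basis.
End Amalgam.

(** * A concrete model of the amalgam *)

Section Construction.
Variables (G1 G2 : sgraph) (c1 : G1) (c2 : G2).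
Hypothesis uc2 : universal c2.

(* The identified vertex is [inl c1]. *)
Definition amalgam_adj : rel (G1 + {y : G2 | y != c2}) := fun u v =>
  match u, v with
  | inl x, inl x' => adj x x'
  | inr y, inr y' => adj (val y) (val y')
  | _, _ => true
  end.

Lemma amalgam_adj_sym : symmetric amalgam_adj.
Proof. by case=> x [] y //=; apply: adj_sym. Qed.

Lemma amalgam_adj_irrefl : irreflexive amalgam_adj.
Proof. by case=> x /=; apply: adj_irrefl. Qed.

Definition amalgam : sgraph := SGraph amalgam_adj_sym amalgam_adj_irrefl.

Definition amalgam_inl (x : G1) : amalgam := inl x.

(** [insub] fails only at [c2], so the default value performs the identification with [c1]. *)
Definition amalgam_inr (y : G2) : amalgam :=
  if insub y is Some y' then inr y' else inl c1.

Lemma amalgam_inr_c2 : amalgam_inl c1 = amalgam_inr c2.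
Proof. by rewrite /amalgam_inr insubF ?eqxx. Qed.

Lemma amalgam_inr_neq y (yc : y != c2) : amalgam_inr y = inr (exist _ y yc).
Proof. by rewrite /amalgam_inr insubT. Qed.

Lemma amalgam_inr_inj : injective amalgam_inr.
Proof.
move=> y y'; have [->|yc] := eqVneq y c2; have [->|yc'] := eqVneq y' c2 => //;
  rewrite -?amalgam_inr_c2 ?amalgam_inr_neq //.
by case.
Qed.

(** The image of [c2] is [inl c1], adjacent to the whole right summand; this agrees with [G2]
    because [c2] is universal. *)
Lemma amalgam_inr_adj : {mono amalgam_inr : y y' / adj y y'}.
Proof.
move=> y y'; have [->|yc] := eqVneq y c2; have [->|yc'] := eqVneq y' c2;
  rewrite -?amalgam_inr_c2 ?amalgam_inr_neq //= ?adj_irrefl ?uc2 //.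
by rewrite adj_sym uc2.
Qed.

Lemma amalgam_cross_adj x y : y != c2 -> adj (amalgam_inl x) (amalgam_inr y).
Proof. by move=> yc; rewrite amalgam_inr_neq. Qed.

Lemma amalgam_cover z : z \in codom amalgam_inl \/ z \in codom amalgam_inr.
Proof.
case: z => [x|[y yc]]; [left | right]; first exact: codom_f.
by rewrite -amalgam_inr_neq codom_f.
Qed.

End Construction.

(** * Unique bases as equality cases, and the conclusion *)

(** The [leqif] form holds minimality and uniqueness in one statement, so that the bounds for two
    graphs can be added together with their equality cases. *)
Lemma unique_basis_leqif (G : sgraph) :
  (exists! W : {set G}, metric_basis W) ->
  exists W0 : {set G}, [/\ resolving W0, #|W0| = metric_dim G
    & forall W : {set G}, resolving W -> #|W0| <= #|W| ?= iff (W == W0)].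
Proof.
case=> W0 [/andP[rW0 /eqP cW0] uniqW0]; exists W0; split=> // W rW.
have [_ mind] := metric_dimP G.
split; first by rewrite cW0 mind.
apply/eqP/eqP=> [E|->//]; apply/esym/uniqW0.
by rewrite /metric_basis rW -E cW0 eqxx.
Qed.

Lemma leqif_basis_unique (G : sgraph) (W0 : {set G}) :
  (forall W : {set G}, resolving W -> #|W0| <= #|W| ?= iff (W == W0)) ->
  forall W : {set G}, resolving W -> #|W| = #|W0| -> W = W0.
Proof. by move=> minW W /minW[_ E] cW; apply/eqP; rewrite -E cW. Qed.

Theorem theorem7 (G1 G2 : sgraph) (n1 n2 k1 k2 : nat)
    (conn1 : connected_graph G1) (order1 : #|G1| = n1)
    (dim1 : metric_dim G1 = k1)
    (uniq1 : exists! W : {set G1}, metric_basis W)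
    (maxdeg1 : max_degree G1 = n1 - 1)
    (conn2 : connected_graph G2) (order2 : #|G2| = n2)
    (dim2 : metric_dim G2 = k2)
    (uniq2 : exists! W : {set G2}, metric_basis W)
    (maxdeg2 : max_degree G2 = n2 - 1) :
  exists G : sgraph,
    connected_graph G /\
    #|G| = n1 + n2 - 1 /\
    metric_dim G = k1 + k2 /\
    (exists! W : {set G}, metric_basis W) /\
    max_degree G = n1 + n2 - 2.
Proof.
have [c1 uc1] : exists c : G1, universal c.
  by apply: universal_exists; rewrite // order1 -subn1.
have [c2 uc2] : exists c : G2, universal c.
  by apply: universal_exists; rewrite // order2 -subn1.
have [W1 [rW1 cardW1 minW1]] := unique_basis_leqif uniq1.
have [W2 [rW2 cardW2 minW2]] := unique_basis_leqif uniq2.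
have cW1 : c1 \notin W1.
  apply: (universal_notin_unique_basis uc1 rW1); first by move=> W /minW1[].
  exact: leqif_basis_unique.
have cW2 : c2 \notin W2.
  apply: (universal_notin_unique_basis uc2 rW2); first by move=> W /minW2[].
  exact: leqif_basis_unique.
pose f1 := @amalgam_inl G1 G2 c2; pose f2 := @amalgam_inr G1 G2 c1 c2.
have f1_inj : injective f1 by move=> x y [].
have f2_inj : injective f2 := @amalgam_inr_inj G1 G2 c1 c2.
have f1_adj : {mono f1 : x y / adj x y} by [].
have f2_adj : {mono f2 : x y / adj x y} := amalgam_inr_adj c1 uc2.
have f12 : f1 c1 = f2 c2 := amalgam_inr_c2 c1 c2.
have cross x y : x != c1 -> y != c2 -> adj (f1 x) (f2 y).
  by move=> _; apply: amalgam_cross_adj.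
have cover := @amalgam_cover G1 G2 c1 c2.
have uc := amalgam_universal uc1 uc2 f1_inj f2_inj f1_adj f2_adj f12 cover.
have cardG : #|amalgam G1 c2| = n1 + n2 - 1.
  by rewrite -order1 -order2 (amalgam_order f1_inj f2_inj f12 cross cover) addnK.
have cardW := amalgam_basis_card f1_inj f2_inj f12 cross cover cW1 cW2.
have minW := amalgam_basis_min uc1 uc2 f1_inj f2_inj f1_adj f2_adj f12 cross
  cover cW1 cW2 minW1 minW2.
have rW := amalgam_basis_resolving uc1 uc2 f1_inj f2_inj f1_adj f2_adj f12 cross
  cover rW1 rW2 cW1.
have [dimG uniqG] := unique_basisP rW (fun W r => (minW W r).1)
  (leqif_basis_unique minW).
exists (amalgam G1 c2); split; first exact: universal_connected uc.
split=> //; split; first by rewrite dimG cardW cardW1 cardW2 dim1 dim2.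
by split=> //; rewrite (universal_max_degree uc) cardG -subn1 -subnDA.
Qed.
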